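(* Let $\Pi$ be a translation-invariant point process on $\mathbb{R}^d$ of finite, positive intensity, and let $\Pi^*$ be its Palm version. If $\Pi^*-\delta_0\prec\Pi$, then $\Pi$ is deletion-tolerant.
   Context: Point processes are always simple and locally finite, i.e. random elements of the space $\mathbb{M}$ of simple locally finite point measures on $\mathbb{R}^d$, equipped with the $\sigma$-field $\mathfrak{M}$ generated by the evaluations $\mu\mapsto\mu(A)$, $A$ Borel. The support of $\mu\in\mathbb{M}$ is $[\mu]=\{y:\mu(\{y\})=1\}$. A point process is translation-invariant if its law is invariant under all translations of $\mathbb{R}^d$; its intensity is then $\lambda=\mathbb{E}\,\Pi([0,1]^d)$. For random variables $X,Y$ with values in the same measurable space, $X\prec Y$ means that $\mathbb{P}(Y\in\mathcal{A})=0$ implies $\mathbb{P}(X\in\mathcal{A})=0$ for all measurable $\mathcal{A}$. For $x\in\mathbb{R}^d$, $\delta_x$ is the point measure at $x$. A $\Pi$-point is an $\mathbb{R}^d$-valued random variable $Z$, defined on the same probability space as $\Pi$, such that $Z\in[\Pi]$ almost surely. $\Pi$ is deletion-tolerant if $\Pi-\delta_Z\prec\Pi$ for every $\Pi$-point $Z$. For $x\in\mathbb{R}^d$ let $\theta_x$ be the translation $y\mapsto y+x$, acting on measures by $(\theta_x\mu)(S)=\mu(\theta_x^{-1}S)$ and on sets of measures by $\theta_x\mathcal{A}=\{\theta_x\mu:\mu\in\mathcal{A}\}$. The Palm version of $\Pi$ (of intensity $\lambda\in(0,\infty)$) is the point process $\Pi^*$ such that for all $\mathcal{A}\in\mathfrak{M}$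 and all Borel $S$ of finite Lebesgue measure $\mathcal{L}(S)$, $$\mathbb{E}\,\#\{x\in[\Pi]\cap S:\ \Pi\in\theta_x\mathcal{A}\}=\lambda\,\mathcal{L}(S)\,\mathbb{P}(\Pi^*\in\mathcal{A}).$$ *)

(* Defs.v *)
From HB Require Import structures.
From mathcomp Require Import all_boot all_order all_algebra.
From mathcomp Require Import all_classical all_reals all_analysis.
From mathcomp Require Import measurable_realfun.
Set Implicit Arguments.
Unset Strict Implicit.
Unset Printing Implicit Defensive.
Import Order.TTheory GRing.Theory Num.Theory.
Import numFieldNormedType.Exports.
Local Open Scope classical_set_scope.
Local Open Scope ring_scope.

(* R^d is 'rV[R]_d with its Borel sigma-algebra. *)
HB.instance Definition _ (R : realType) (d : nat) :=
  @isMeasurable.Build (sigma_display (@open 'rV[R]_d)) 'rV[R]_d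
    <<s @open 'rV[R]_d >> (@sigma_algebra0 _ setT _) (@sigma_algebraC _ _)
    (@sigma_algebra_bigcup _ setT _).

Section lebesgue.
Context {R : realType} {d : nat}.
Implicit Types a b v : 'rV[R]_d.

Definition box a b : set 'rV[R]_d :=
  [set v | forall i, a ord0 i <= v ord0 i <= b ord0 i].

Definition box_volume a b : R := \prod_(i < d) (b ord0 i - a ord0 i).

(* Lebesgue outer measure for d > 0 (a box of R^0 is never empty and has
   volume 1); Lebesgue measure is its restriction to measurable sets. *)
Definition lebesgue_rV (S : set 'rV[R]_d) : \bar R :=
  ereal_inf [set s | exists a b : nat -> 'rV[R]_d,
    [/\ forall k i, a k ord0 i <= b k ord0 i,
        S `<=` \bigcup_k box (a k) (b k) &
        s = (\sum_(k <oo) (box_volume (a k) (b k))%:E)%E]].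

Definition unit_cube : set 'rV[R]_d := box (const_mx 0) (const_mx 1).

End lebesgue.

Section point_measures.
Context {R : realType} {d : nat}.
Local Open Scope ereal_scope.
Implicit Types (I : set nat) (p : nat -> 'rV[R]_d) (m : set 'rV[R]_d -> \bar R).

Definition diracs I p (A : set 'rV[R]_d) : \bar R := \esum_(i in I) \d_(p i) A.

(* The equality bears on all subsets of R^d, Borel or not: a sum of Dirac
   masses extends canonically to all of them, so that a point measure is
   determined as a set function. *)
Definition is_point_measure m := exists I p, m = diracs I p.

Definition is_simple m := forall y, m [set y] <= 1.

Definition is_locally_finite m :=
  forall A : set 'rV[R]_d, measurable A -> bounded_set A -> m A < +oo.

Let dirac_or_zero I p i : {measure set 'rV[R]_d -> \bar R} :=
  if i \in I then [the {measure set 'rV[R]_d -> \bar R} of \d_(p i)] else mzero.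

Lemma diracsE I p : diracs I p = mseries (dirac_or_zero I p) 0.
Proof.
apply/funext => A; rewrite /diracs /mseries nneseries_esumT; last first.
  by move=> i; exact: measure_ge0.
rewrite esum_mkcond; apply: eq_esum => i _.
by rewrite /dirac_or_zero; case: ifPn.
Qed.

Lemma diracs_ge0 I p A : 0 <= diracs I p A.
Proof. by rewrite diracsE measure_ge0. Qed.

Lemma diracs_supportP I p y : 0 < diracs I p [set y] -> exists2 i, I i & p i = y.
Proof.
move=> h; apply/not_exists2P => np; move: h.
rewrite /diracs esum1 ?ltxx// => i Ii; rewrite diracE memNset//= => piy.
by have [] := np i.
Qed.

Lemma diracsD1 I p i A : I i ->
  diracs I p A = \d_(p i) A + diracs (I `\ i) p A.
Proof.
move=> Ii; rewrite /diracs (esumID [set i]) //.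
by rewrite setIidr ?sub1set ?inE// -setDE esum_set1.
Qed.

End point_measures.

Record pmeasure (R : realType) (d : nat) := PMeasure {
  pmeasure_fun :> set 'rV[R]_d -> \bar R ;
  pmeasure_point : is_point_measure pmeasure_fun ;
  pmeasure_simple : is_simple pmeasure_fun ;
  pmeasure_locally_finite : is_locally_finite pmeasure_fun }.

Section pmeasure_theory.
Context {R : realType} {d : nat}.
Local Open Scope ereal_scope.
Implicit Types (mu : pmeasure R d) (x y : 'rV[R]_d).

Lemma pmeasure_eq mu mu' :
  pmeasure_fun mu = pmeasure_fun mu' -> mu = mu'.
Proof.
case: mu mu' => [f a b c] [f' a' b' c'] /= ff'; rewrite -{f'}ff' in a' b' c' *.
by congr PMeasure; exact: Prop_irrelevance.
Qed.

Section pmeasure_is_measure.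
Variable mu : pmeasure R d.

Let mu0 : mu set0 = 0.
Proof. by have [I [p ->]] := pmeasure_point mu; rewrite diracsE measure0. Qed.

Let mu_ge0 A : 0 <= mu A.
Proof. by have [I [p ->]] := pmeasure_point mu; exact: diracs_ge0. Qed.

Let mu_sigma_additive : semi_sigma_additive mu.
Proof.
have [I [p ->]] := pmeasure_point mu; rewrite diracsE.
exact: measure_semi_sigma_additive.
Qed.

HB.instance Definition _ := isMeasure.Build _ _ _ (pmeasure_fun mu)
  mu0 mu_ge0 mu_sigma_additive.

End pmeasure_is_measure.

Definition pm_support mu : set 'rV[R]_d := [set y | mu [set y] = 1].

Let zero_point : is_point_measure (cst 0 : set 'rV[R]_d -> \bar R).
Proof.
by exists set0, (fun=> point); apply/funext => A; rewrite /diracs esum_set0.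
Qed.

Let zero_simple : is_simple (cst 0 : set 'rV[R]_d -> \bar R).
Proof. by move=> y; exact: lee01. Qed.

Let zero_locally_finite : is_locally_finite (cst 0 : set 'rV[R]_d -> \bar R).
Proof. by move=> A _ _; exact: ltry. Qed.

Definition pmeasure0 : pmeasure R d :=
  PMeasure zero_point zero_simple zero_locally_finite.

HB.instance Definition _ := gen_eqMixin (pmeasure R d).
HB.instance Definition _ := gen_choiceMixin (pmeasure R d).
HB.instance Definition _ := isPointed.Build (pmeasure R d) pmeasure0.

Definition pmeasure_ev (A : set 'rV[R]_d) mu : \bar R := mu A.

Definition pmeasure_evals : set (set (pmeasure R d)) :=
  \bigcup_(A in measurable)
    preimage_set_system [set: pmeasure R d] (pmeasure_ev A) measurable.

Definition pmeasure_display : measure_display.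
Proof. by constructor. Qed.

HB.instance Definition _ := @isMeasurable.Build pmeasure_display (pmeasure R d)
  <<s pmeasure_evals >> (@sigma_algebra0 _ setT _) (@sigma_algebraC _ _)
  (@sigma_algebra_bigcup _ setT _).

Section translate.
Variables (x : 'rV[R]_d) (mu : pmeasure R d).

Let theta (A : set 'rV[R]_d) : \bar R := pushforward mu (fun y => y + x)%R A.

Let theta_point : is_point_measure theta.
Proof.
have [I [p mup]] := pmeasure_point mu.
exists I, (fun i => p i + x)%R; apply/funext => A.
rewrite /theta /pushforward mup; apply: eq_esum => i _; rewrite !diracE.
by congr (_%:R%:E); congr nat_of_bool; apply/idP/idP; rewrite !inE.
Qed.

Let theta_simple : is_simple theta.
Proof.
move=> y; rewrite /theta /pushforward; have := pmeasure_simple mu (y - x)%R.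
congr (mu _ <= _); apply/seteqP; split => z /=.
  by move=> ->; rewrite subrK.
by move=> <-; rewrite addrK.
Qed.

Let theta_locally_finite : is_locally_finite theta.
Proof.
move=> A _ /ex_strict_bound_gt0[M M0 AM].
pose B := ball (0 : 'rV[R]_d)%R (M + `|x|)%R.
have openB : open B by exact: ball_open.
have mB : measurable B by exact: sub_sigma_algebra.
have bB : bounded_set B.
  exists (M + `|x|)%R; split; first exact: num_real.
  move=> N MN y; rewrite /B -ball_normE/= sub0r normrN => yM.
  exact: ltW (lt_trans yM MN).
have := pmeasure_locally_finite mu mB bB; apply: le_lt_trans.
rewrite /theta /pushforward; have [I [p ->]] := pmeasure_point mu.
apply: le_esum => i _; rewrite !diracE lee_fin ler_nat.
have [|//] := boolP (p i \in _ @^-1` _); rewrite inE/= => /AM/= pixM.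
rewrite mem_set//; rewrite /B -ball_normE/= sub0r normrN.
rewrite -[p i](addrK x) (le_lt_trans (ler_normB _ _))//.
by rewrite ltrD2r.
Qed.

Definition translate : pmeasure R d :=
  PMeasure theta_point theta_simple theta_locally_finite.

End translate.

Section remove_point.
Variables (mu : pmeasure R d) (x : 'rV[R]_d).

Let remove (A : set 'rV[R]_d) : \bar R :=
  if x \in pm_support mu then mu A - \d_x A else mu A.

Let remove_le A : remove A <= mu A.
Proof. by rewrite /remove; case: ifPn => // _; rewrite geeDl// oppe_le0. Qed.

Let remove_point_ : is_point_measure remove.
Proof.
have [I [p mup]] := pmeasure_point mu.
rewrite /remove; have [|_] := boolP (x \in pm_support mu); last first.
  by exists I, p; apply/funext => A; rewrite mup.
rewrite inE /pm_support/= mup => mux.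
have [|i Ii pix] := @diracs_supportP _ _ I p x; first by rewrite mux.
exists (I `\ i), p; apply/funext => A.
rewrite (diracsD1 p A Ii) pix.
rewrite -[LHS]/(\d_x A + diracs (I `\ i) p A - \d_x A) addeAC.
by rewrite subee ?add0e// diracE.
Qed.

Let remove_simple : is_simple remove.
Proof. by move=> y; exact: le_trans (remove_le _) (pmeasure_simple mu y). Qed.

Let remove_locally_finite : is_locally_finite remove.
Proof.
move=> A mA bA.
exact: le_lt_trans (remove_le _) (pmeasure_locally_finite mu mA bA).
Qed.

(* mu - delta_x when x is in the support of mu.  Otherwise mu - delta_x is not
   a measure, and the value is conventionally mu. *)
Definition remove_point : pmeasure R d :=
  PMeasure remove_point_ remove_simple remove_locally_finite.

End remove_point.

End pmeasure_theory.

Section random_elements.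
Local Open Scope ereal_scope.

Definition prec (R : realType) (d1 d2 dT : measure_display)
    (O1 : measurableType d1) (P1 : probability O1 R)
    (O2 : measurableType d2) (P2 : probability O2 R)
    (T : measurableType dT) (X : O1 -> T) (Y : O2 -> T) :=
  forall A : set T, measurable A -> P2 (Y @^-1` A) = 0 -> P1 (X @^-1` A) = 0.

Context {R : realType} {d : nat} {dO : measure_display}
  {Omega : measurableType dO}.
Variable P : probability Omega R.
Implicit Types (Pi : {RV P >-> pmeasure R d}) (Z : {RV P >-> 'rV[R]_d}).

Definition translation_invariant Pi :=
  forall (x : 'rV[R]_d) (A : set (pmeasure R d)), measurable A ->
    P ((translate x \o Pi) @^-1` A) = P (Pi @^-1` A).

Definition intensity Pi : \bar R := \int[P]_w Pi w unit_cube.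

Definition is_point_of Pi Z := {ae P, forall w, pm_support (Pi w) (Z w)}.

Definition deletion_tolerant Pi :=
  forall Z, is_point_of Pi Z -> prec P P (fun w => remove_point (Pi w) (Z w)) Pi.

Definition is_palm_version Pi (dO' : measure_display)
    (Omega' : measurableType dO') (P' : probability Omega' R)
    (Pis : {RV P' >-> pmeasure R d}) :=
  forall (A : set (pmeasure R d)) (S : set 'rV[R]_d),
    measurable A -> measurable S -> lebesgue_rV S < +oo ->
    \int[P]_w counting (pm_support (Pi w) `&` S `&`
                        [set x | (translate x @` A) (Pi w)]) =
    intensity Pi * lebesgue_rV S * P' (Pis @^-1` A).

End random_elements.

Arguments prec {R d1 d2 dT O1} P1 {O2} P2 {T} X Y.
Arguments translation_invariant {R d dO Omega} P Pi.
Arguments intensity {R d dO Omega} P Pi.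
Arguments is_point_of {R d dO Omega} P Pi Z.
Arguments deletion_tolerant {R d dO Omega} P Pi.
Arguments is_palm_version {R d dO Omega} P Pi {dO' Omega'} P' Pis.

(* Main.v *)
Require Import Defs.
From HB Require Import structures.
From mathcomp Require Import all_boot all_order all_algebra.
From mathcomp Require Import all_classical all_reals all_analysis.
From mathcomp Require Import measurable_realfun.
From mathcomp Require Import ring.
Import Order.TTheory GRing.Theory Num.Theory.
Import numFieldNormedType.Exports.
Local Open Scope classical_set_scope.
Local Open Scope ring_scope.
Local Open Scope ereal_scope.

(** Let A be a null set for the law of Pi. It has to be shown that almost
    surely no point x of Pi is such that Pi - delta_x lies in A. Seen from x,
    the configuration Pi - delta_x is nu - delta_0, where nu is Pi translated
    by -x, and Pi - delta_x lies in A exactly when nu - delta_0 lies in A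
    translated by -x.

    The expected number of such points in a ball is given by the refined
    Campbell formula: the pair (x, nu), with x summed over the points of Pi in
    the ball, is distributed as a multiple of Lebesgue measure times the law of
    the Palm version. For fixed x, translation invariance makes the translate
    of A null for Pi, and the hypothesis on the Palm version Pi* then says that
    Pi* - delta_0 almost surely avoids it. So every x-section of the bad set of
    pairs is null, and the expected number of bad points in the ball vanishes;
    letting the ball grow, any Pi-point Z is almost surely good.

    The definition of the Palm version only provides the Campbell formula on
    rectangles S x B. Passing to the bad set, which is not a rectangle, is the
    substance of the proof. Three facts make it work: the Campbell measure is a
    measure, which rests on the measurability of t |-> F t (A_t) for a random
    point measure F and a measurable A with sections A_t
    ([measurable_pmeasure_xsection]); the translation of a point measure is
    jointly measurable in the vector and the measure ([measurable_translate]);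
    and a finite measure which factorizes on rectangles is a product measure
    ([product_null_sections]). *)

(** * Borel sets and volume in R^d *)

Section borel_rV.
Context {R : realType} {d : nat}.
Local Open Scope ring_scope.

Lemma open_rV_measurable (U : set 'rV[R]_d) : open U -> measurable U.
Proof. by move=> oU; exact: sub_sigma_algebra. Qed.

Lemma measurable_ball (x : 'rV[R]_d) (r : R) : measurable (ball x r).
Proof. by apply: open_rV_measurable; exact: ball_open. Qed.

Lemma measurable_set1_rV (x : 'rV[R]_d) : measurable [set x].
Proof.
have acc : accessible_space 'rV[R]_d.
  exact: hausdorff_accessible (@norm_hausdorff _ _).
rewrite -(setCK [set x]); apply: measurableC; apply: open_rV_measurable.
exact: closed_openC (@accessible_closed_set1 _ acc x).
Qed.

Lemma rV_rat_approx (x : 'rV[R]_d) {e : R} : 0 < e ->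
  exists q : 'rV[rat]_d, ball x e (map_mx ratr q).
Proof.
move=> e0.
have h i : exists q : rat, x ord0 i - e < ratr q < x ord0 i + e.
  have [|q] := @rat_in_itvoo R (x ord0 i - e) (x ord0 i + e).
    by rewrite ltrD2l gtrN.
  by rewrite in_itv => qe; exists q.
have [q hq] := choice h.
exists (\row_i q i); split=> // i j; rewrite /ball/= !mxE.
by rewrite (ord1 i) distrC ltr_distl; exact: hq.
Qed.

(** Addition is continuous, but this only makes it measurable for the Borel
    sigma-algebra of the product topology. The product sigma-algebra is reached
    through second countability: the preimage of an open set is the union of
    the countably many rectangles of balls with rational centres and radius
    1/(n+1) that it contains. *)
Lemma measurable_addrV :
  measurable_fun setT (fun z : 'rV[R]_d * 'rV[R]_d => z.1 + z.2).
Proof.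
apply: (@measurability _ _ _ _ _ _ (@open 'rV[R]_d)) => //.
move=> _ [U oU <-]; rewrite setTI.
pose r (q : 'rV[rat]_d) : 'rV[R]_d := map_mx ratr q.
pose rect (t : 'rV[rat]_d * 'rV[rat]_d * nat) : set ('rV[R]_d * 'rV[R]_d) :=
  ball (r t.1.1) t.2.+1%:R^-1 `*` ball (r t.1.2) t.2.+1%:R^-1.
have -> : (fun z : 'rV[R]_d * 'rV[R]_d => z.1 + z.2) @^-1` U =
    \bigcup_(t in [set t | rect t `<=` (fun z => z.1 + z.2) @^-1` U]) rect t.
  apply/seteqP; split => [[x y]/= Uxy|z [t /= tU zt]]; last exact: tU.
  have /nbhs_ballP[e /= e0 eU] : nbhs (x + y) U by exact: open_nbhs_nbhs.
  (* In the rectangle, each term is within 2/(n+1) of x or y, so that the sum is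
     within 4/(n+1) of x + y. *)
  have [n ne] : exists n, n.+1%:R^-1 < e / 4.
    have /ltr_add_invr[n] : 0 < e / 4 by rewrite divr_gt0.
    by rewrite add0r; exists n.
  have n0 : 0 < n.+1%:R^-1 :> R by rewrite invr_gt0.
  have [q xq] := rV_rat_approx x n0; have [q' yq'] := rV_rat_approx y n0.
  exists (q, q', n); last by split; exact: ball_sym.
  move=> [u v] [/= qu q'v]; apply: eU; rewrite -ball_normE/=.
  have xu := ball_triangle xq qu; have yv := ball_triangle yq' q'v.
  move: xu yv; rewrite -!ball_normE/= => xu yv.
  rewrite opprD addrACA (le_lt_trans (ler_normD _ _))//.
  rewrite (lt_trans (ltrD xu yv))//.
  rewrite (_ : e = e / 4 + e / 4 + (e / 4 + e / 4)); last by field.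
  by rewrite !ltrD.
rewrite bigcup_mkcond; apply: countable_bigcupT_measurable => [|t].
  exact: countableP.
case: ifPn => // _; apply: measurableX; exact: measurable_ball.
Qed.

Lemma measurable_opprV : measurable_fun setT (fun x : 'rV[R]_d => - x).
Proof.
apply: (@measurability _ _ _ _ _ _ (@open 'rV[R]_d)) => //.
move=> _ [U oU <-]; rewrite setTI; apply: open_rV_measurable.
by apply: open_comp => // x _; exact: opp_continuous.
Qed.

Lemma ball0_nondecreasing :
  nondecreasing_seq (fun n => ball (0 : 'rV[R]_d) n%:R : set 'rV[R]_d).
Proof. by move=> m n mn; apply/subsetPset; apply: le_ball; rewrite ler_nat. Qed.

Lemma bigcup_ball0 : \bigcup_n ball (0 : 'rV[R]_d) n%:R = setT.
Proof.
apply/seteqP; split => // x _; exists (Num.trunc `|x|).+1 => //.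
by rewrite -ball_normE/= sub0r normrN truncnS_gt.
Qed.

End borel_rV.

Section lebesgue_ball.
Context {R : realType} {d : nat}.

Lemma le_lebesgue_rV (A B : set 'rV[R]_d) :
  A `<=` B -> lebesgue_rV A <= lebesgue_rV B.
Proof.
move=> AB; apply: ereal_inf_le_tmp => s [a [b [ab Bab sE]]].
by exists a, b; split => //; exact: subset_trans Bab.
Qed.

(** The ball is covered by one cube followed by copies of the degenerate box
    {0}, which have volume 0 in positive dimension. *)
Lemma lebesgue_rV_ball_lty (r : R) :
  (0 < d)%N -> lebesgue_rV (ball (0 : 'rV[R]_d)%R r) < +oo.
Proof.
move=> d0; pose a k : 'rV[R]_d := if k is 0 then const_mx (- `|r|)%R else 0%R.
pose b k : 'rV[R]_d := if k is 0 then const_mx `|r|%R else 0%R.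
apply: (@le_lt_trans _ _ (\sum_(k <oo) (box_volume (a k) (b k))%:E)).
  apply: ereal_inf_lbound; exists a, b; split => //.
    by move=> [|k] i; rewrite !mxE// ge0_cp.
  move=> x [_ xr]; exists 0%N => // i; rewrite !mxE -ler_norml.
  have := xr ord0 i; rewrite /ball/= mxE sub0r normrN => xir.
  exact: le_trans (ltW xir) (ler_norm r).
have vol0 k : (1 <= k)%N -> (box_volume (a k) (b k))%:E = 0.
  case: k => // k _; congr EFin; rewrite /box_volume (bigD1 (Ordinal d0))//=.
  by rewrite subrr mul0r.
rewrite nneseries_recl//; last first.
  move=> k _; rewrite lee_fin; apply: prodr_ge0 => i _; rewrite subr_ge0.
  by case: k => [|k]; rewrite !mxE// ge0_cp.
by rewrite eseries0 ?adde0 ?ltry// => k k1 _; exact: vol0.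
Qed.

End lebesgue_ball.

(** * Point measures count their support *)

Section counting_points.
Context {R : realType} {d : nat}.
Implicit Types mu : pmeasure R d.

Lemma pm_supportE {mu I p} : pmeasure_fun mu = diracs I p ->
  pm_support mu = p @` I /\ set_inj I p.
Proof.
move=> muE; have mu1 i : I i -> 1 <= mu [set p i].
  move=> Ii; rewrite muE (diracsD1 p _ Ii) diracE mem_set//.
  by rewrite leeDl// diracs_ge0.
split.
  apply/seteqP; split => [y|_ [i Ii <-]].
    rewrite /pm_support/= muE => y1.
    have [|i Ii <-] := @diracs_supportP _ _ I p y; first by rewrite y1.
    by exists i.
  by apply/eqP; rewrite eq_le mu1// pmeasure_simple.
(* A repeated location would carry mass at least 2, against simplicity. *)
move=> i j; rewrite !inE => Ii Ij pij; apply: contrapT => ij.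
have := pmeasure_simple mu (p i).
rewrite muE (diracsD1 p _ Ii) (@diracsD1 _ _ (I `\ i) p j); last first.
  by split => //; exact/nesym.
rewrite !diracE !mem_set//= addeA leNgt => /negP; apply.
rewrite (@lt_le_trans _ _ 2%:E)// ?lte_fin ?ltr1n// leeDl// diracs_ge0//.
Qed.

(** This turns the counting integrals that define the Palm version into
    integrals against the random measure, to which measure theory applies. *)
Lemma pmeasure_counting mu A : mu A = counting (pm_support mu `&` A).
Proof.
have [I [p muE]] := pmeasure_point mu.
have [-> pI] := pm_supportE muE.
have -> : p @` I `&` A = p @` (I `&` p @^-1` A).
  apply/seteqP; split => [_ [[i Ii <-] Api]|_ [i [Ii Api] <-]].
    by exists i.
  by split => //; exists i.
have pIA : set_inj (I `&` p @^-1` A) p.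
  by move=> i j; rewrite !inE => -[Ii _] [Ij _]; apply: pI; rewrite inE.
transitivity (counting (I `&` p @^-1` A) : \bar R).
  rewrite counting_dirac muE /diracs nneseries_esumT; last by [].
  rewrite esum_mkcond; apply: eq_esum => i _.
  by rewrite !diracE in_setI; case: ifPn.
have sameC := inj_card_eq pIA.
rewrite /counting (eq_finite_set sameC); case: ifPn => // /asboolP fin.
congr (_%:R%:E); apply/esym/fcard_eq => //; exact: finite_image.
Qed.

End counting_points.

(** * Measurability of maps to and from point measures *)

Section measurable_pmeasure.
Context {R : realType} {d : nat} {dT : measure_display} {T : measurableType dT}.
Implicit Types F : T -> pmeasure R d.

Lemma measurable_pmeasure_ev {B : set 'rV[R]_d} : measurable B ->
  measurable_fun setT (pmeasure_ev B : pmeasure R d -> \bar R).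
Proof.
by move=> mB _ Y mY; apply: sub_sigma_algebra; exists B => //; exists Y.
Qed.

Lemma measurable_pmeasureP F :
  (forall B, measurable B -> measurable_fun setT (fun t => F t B)) <->
  measurable_fun setT F.
Proof.
split=> [mF|mF B mB]; last first.
  exact: measurableT_comp (measurable_pmeasure_ev mB) mF.
apply: (@measurability _ _ _ _ _ _ (@pmeasure_evals R d)) => //.
move=> _ [_ [B mB [Y mY <-]] <-]; rewrite !setTI.
by rewrite -[X in measurable X]setTI; exact: mF.
Qed.

Section kernel.
Variables (F : T -> pmeasure R d) (mF : measurable_fun setT F).

(** The measurability proof is an argument so that the kernel structure can be
    attached to the term. *)
Definition pmeasure_kernel of measurable_fun setT F :
  T -> {measure set 'rV[R]_d -> \bar R} := fun t => F t.

Let measurable_kernel U : measurable U ->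
  measurable_fun setT (pmeasure_kernel mF ^~ U).
Proof. by move=> mU; exact: (measurable_pmeasureP F).2. Qed.

HB.instance Definition _ := @isKernel.Build _ _ _ _ R (pmeasure_kernel mF)
  measurable_kernel.

End kernel.

Lemma pmeasure_ball_fin (mu : pmeasure R d) (r : R) :
  mu (ball (0 : 'rV[R]_d)%R r) < +oo.
Proof.
apply: pmeasure_locally_finite; first exact: measurable_ball.
exists `|r|%R; split; first exact: num_real.
move=> N rN y; rewrite -ball_normE/= sub0r normrN => yr.
exact: ltW (lt_trans yr (le_lt_trans (ler_norm _) rN)).
Qed.

(** The kernel F is not uniformly bounded, only finite on each ball for each t,
    so the usual statement for finite kernels is applied on balls and the limit
    is taken along their increasing radii. *)
Lemma measurable_pmeasure_xsection F (A : set (T * 'rV[R]_d)) :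
  measurable_fun setT F -> measurable A ->
  measurable_fun setT (fun t => F t (xsection A t)).
Proof.
move=> mF mA; pose K n : set 'rV[R]_d := ball (0 : 'rV[R]_d)%R n%:R.
have mK n : measurable (K n) by exact: measurable_ball.
have mAt t : measurable (xsection A t) by exact: measurable_xsection.
apply: (emeasurable_fun_cvg (fun n t => F t (xsection A t `&` K n))) => [n|t _].
  have [|_] := @measurable_prod_subset_xsection_kernel _ _ _ _ R
    (pmeasure_kernel F mF) _ (mK n) _ A mA; last exact.
  move=> t; exists (fine (F t (K n)) + 1)%R => X mX.
  have Kfin : F t (K n) \is a fin_num.
    by rewrite ge0_fin_numE ?measure_ge0//; exact: pmeasure_ball_fin.
  rewrite EFinD fineK// (@le_lt_trans _ _ (F t (K n)))//.
    by rewrite /mrestr le_measure// inE//; exact: measurableI.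
  by rewrite lteDl// lte_fin.
rewrite -[X in _ --> F t X]setIT -bigcup_ball0 setI_bigcupr.
apply: (@nondecreasing_cvg_mu _ _ _ (F t)) => [n||].
- exact: measurableI.
- by apply: bigcup_measurable => n _; exact: measurableI.
- move=> m n mn; apply/subsetPset; apply: setIS; apply/subsetPset.
  exact: ball0_nondecreasing.
Qed.

End measurable_pmeasure.

(** * Translations and removal of a point *)

Section translation.
Context {R : realType} {d : nat}.
Implicit Types (mu : pmeasure R d) (x y : 'rV[R]_d).

Lemma translateE x mu B : translate x mu B = mu [set y | B (y + x)%R].
Proof. by []. Qed.

Lemma translateK x mu : translate (- x)%R (translate x mu) = mu.
Proof.
apply: pmeasure_eq; apply/funext => B.
rewrite (translateE (- x)%R) (translateE x); congr (mu _).
by apply/seteqP; split => y /=; rewrite addrK.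
Qed.

Lemma translateNK x mu : translate x (translate (- x)%R mu) = mu.
Proof. by rewrite -{1}[x]opprK translateK. Qed.

Lemma translate_image x (A : set (pmeasure R d)) mu :
  (translate x @` A) mu <-> A (translate (- x)%R mu).
Proof.
split=> [[nu Anu <-]|Amu]; first by rewrite translateK.
by exists (translate (- x)%R mu) => //; rewrite translateNK.
Qed.

Lemma pm_support_translate x y mu :
  pm_support (translate x mu) y = pm_support mu (y - x)%R.
Proof.
rewrite -[LHS]/(mu [set z | (z + x)%R = y] = 1)
  -[RHS]/(mu [set (y - x)%R] = 1); congr (mu _ = 1).
by apply/seteqP; split => z /= => [<-|->]; rewrite ?addrK ?subrK.
Qed.

Lemma remove_pointE mu x B :
  remove_point mu x B = if x \in pm_support mu then mu B - \d_x B else mu B.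
Proof. by []. Qed.

(** Removing x is recentring at x, removing the origin and translating back.
    This is what lets the hypothesis on the Palm version, which only speaks of
    the origin, say something about the points of the process. *)
Lemma remove_point_translate mu x :
  remove_point mu x = translate x (remove_point (translate (- x)%R mu) 0%R).
Proof.
apply: pmeasure_eq; apply/funext => B.
rewrite (translateE x) (remove_pointE mu) (remove_pointE (translate _ _)).
have -> : (0%R \in pm_support (translate (- x)%R mu)) = (x \in pm_support mu).
  by apply/idP/idP; rewrite !inE pm_support_translate sub0r opprK.
rewrite (translateE (- x)%R); have -> : [set y | B (y - x + x)%R] = B.
  by apply/seteqP; split => z /=; rewrite subrK.
congr (if _ then _ - _ else _); rewrite !diracE; congr (_%:R%:E).
by congr nat_of_bool; apply/idP/idP; rewrite !inE/= add0r.
Qed.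

(** (translate x mu) B is the mu-measure of a section of the set of all triples
    (x, mu, y) with y + x in B, which is measurable because addition is. *)
Lemma measurable_translate :
  measurable_fun setT (fun z : 'rV[R]_d * pmeasure R d => translate z.1 z.2).
Proof.
apply/measurable_pmeasureP => B mB.
pose A := [set u : ('rV[R]_d * pmeasure R d) * 'rV[R]_d | B (u.2 + u.1.1)%R].
have mA : measurable A.
  have mf : measurable_fun setT
      (fun u : ('rV[R]_d * pmeasure R d) * 'rV[R]_d => (u.2 + u.1.1)%R).
    have mp : measurable_fun setT
        (fun u : ('rV[R]_d * pmeasure R d) * 'rV[R]_d => (u.2, u.1.1)).
      apply: measurable_fun_pair => //.
      exact: measurableT_comp measurable_fst measurable_fst.
    exact: measurableT_comp measurable_addrV mp.
  by rewrite -[A]setTI; exact: mf.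
rewrite (_ : (fun _ => _) =
    fun z : 'rV[R]_d * pmeasure R d => z.2 (xsection A z)); last first.
  apply/funext => z; rewrite (translateE z.1); congr (z.2 _).
  by apply/seteqP; split => y; rewrite /xsection/= inE.
exact: measurable_pmeasure_xsection.
Qed.

Lemma measurable_remove_point0 :
  measurable_fun setT (fun mu : pmeasure R d => remove_point mu 0%R).
Proof.
apply/measurable_pmeasureP => B mB.
have msupp : measurable [set mu : pmeasure R d | pm_support mu 0%R].
  have m0 := measurable_pmeasure_ev (measurable_set1_rV (0%R : 'rV[R]_d)).
  rewrite -[X in measurable X]setTI.
  exact: (m0 measurableT _ (emeasurable_set1 1)).
rewrite (_ : (fun _ => _) = fun mu : pmeasure R d =>
  if mu \in [set mu : pmeasure R d | pm_support mu 0%R]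
  then mu B - \d_(0%R : 'rV[R]_d) B else mu B); last first.
  apply/funext => mu; rewrite remove_pointE.
  by congr (if _ then _ else _); apply/idP/idP; rewrite !inE.
apply: measurable_fun_ifT.
- apply: (measurable_fun_bool true); rewrite setTI.
  rewrite [X in measurable X](_ : _ = [set mu | pm_support mu 0%R]) //.
  by apply/seteqP; split => mu; [exact: set_mem|exact: mem_set].
- by apply: emeasurable_funB => //; exact: measurable_pmeasure_ev.
- exact: measurable_pmeasure_ev.
Qed.

End translation.

(** * Null sets of product measures *)

Section product_null.
Context {d1 d2 : measure_display} {T1 : measurableType d1}
  {T2 : measurableType d2} {R : realType}.
Variable m : {measure set (T1 * T2) -> \bar R}.
Hypothesis m_fin : m setT < +oo.

Let marginal : set T1 -> \bar R := pushforward m fst.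

Let marginal0 : marginal set0 = 0.
Proof. by rewrite /marginal /pushforward preimage_set0 measure0. Qed.

Let marginal_ge0 S : 0 <= marginal S.
Proof. exact: measure_ge0. Qed.

Let marginal_sigma_additive : semi_sigma_additive marginal.
Proof.
apply: (@measure_semi_sigma_additive _ _ _ (pushforward m fst)).
exact: measurable_fst.
Qed.

HB.instance Definition _ := isMeasure.Build _ _ _ marginal
  marginal0 marginal_ge0 marginal_sigma_additive.

Let marginal_fin : fin_num_fun marginal.
Proof.
move=> S mS; rewrite ge0_fin_numE ?measure_ge0//.
apply: le_lt_trans m_fin; rewrite /marginal /pushforward.
apply: le_measure; rewrite ?inE//.
by rewrite -[X in measurable X]setTI; exact: (@measurable_fst _ _ T1 T2).
Qed.

HB.instance Definition _ := Measure_isFinite.Build _ _ _ marginal marginal_fin.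

(** The factorization on rectangles makes m the product of its first marginal
    and kappa, by uniqueness of product measures; integrating over sections
    concludes. *)
Lemma product_null_sections (kappa : probability T2 R) (N : set (T1 * T2)) :
  (forall S B, measurable S -> measurable B ->
    m (S `*` B) = m (S `*` setT) * kappa B) ->
  measurable N -> (forall x, kappa (xsection N x) = 0) -> m N = 0.
Proof.
move=> mE mN N0; rewrite -(@product_measure_unique _ _ _ _ _ marginal kappa m).
- by rewrite /product_measure1 integral0_eq// => x _ /=; exact: N0.
- move=> S B mS mB; rewrite mE//; congr (m _ * _).
  by apply/seteqP; split => -[x y] //= [].
- exact: mN.
Qed.

End product_null.

(** * The Campbell measure of a point process *)

Section campbell.
Context {R : realType} {d : nat} {dO : measure_display}
  {Omega : measurableType dO} {P : probability Omega R}
  (Pi : {RV P >-> pmeasure R d}).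

(** Keeping the random outcome w, rather than only Pi w, makes room for events
    that involve further random variables, such as a Pi-point. *)
Definition campbell (Y : set (Omega * 'rV[R]_d)) : \bar R :=
  \int[P]_w Pi w (xsection Y w).

Let measurable_section Y : measurable Y ->
  measurable_fun setT (fun w => Pi w (xsection Y w)).
Proof. by move=> mY; exact: measurable_pmeasure_xsection. Qed.

Let campbell0 : campbell set0 = 0.
Proof.
by rewrite /campbell integral0_eq// => w _; rewrite xsection0 measure0.
Qed.

Let campbell_ge0 Y : 0 <= campbell Y.
Proof. by apply: integral_ge0 => w _; exact: measure_ge0. Qed.

Let campbell_sigma_additive : semi_sigma_additive campbell.
Proof.
move=> F mF tF mUF.
rewrite [X in _ --> X](_ : _ = \sum_(n <oo) campbell (F n)).
  by apply/cvg_closeP; split; [exact: is_cvg_nneseries|rewrite closeE].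
rewrite -integral_nneseries//; last by move=> n; exact: measurable_section.
apply: eq_integral => w _; apply/esym/cvg_lim => //=; rewrite xsection_bigcup.
apply: (measure_sigma_additive _ (trivIset_xsection tF)) => n.
exact: measurable_xsection.
Qed.

HB.instance Definition _ := isMeasure.Build _ _ _ campbell
  campbell0 campbell_ge0 campbell_sigma_additive.

(** If the chosen point Z has the property Y, then some point of the process
    has it; so Y holds for Z with probability at most the expected number of
    points with property Y. *)
Lemma point_le_campbell (Z : {RV P >-> 'rV[R]_d}) (Y : set (Omega * 'rV[R]_d)) :
  is_point_of P Pi Z -> measurable Y -> P [set w | Y (w, Z w)] <= campbell Y.
Proof.
move=> [N [mN N0 subN]] mY; pose f w := Pi w (xsection Y w).
have mf : measurable_fun setT f by exact: measurable_section.
have mf1 : measurable [set w | `|f w| >= 1%:E].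
  rewrite -[X in measurable X]setTI; apply: emeasurable_fun_c_infty => //.
  exact: measurableT_comp.
have mYZ : measurable [set w | Y (w, Z w)].
  have mp : measurable_fun setT (fun w => (w, Z w)).
    exact: measurable_fun_pair.
  by rewrite -[X in measurable X]setTI; exact: mp.
have sub : [set w | Y (w, Z w)] `<=` N `|` [set w | `|f w| >= 1%:E].
  move=> w /= YwZ; have [Nw|Nw] := pselect (N w); [by left|right].
  have Zw : pm_support (Pi w) (Z w) by apply: contrapT => /subN.
  rewrite gee0_abs ?measure_ge0// -Zw le_measure// ?inE.
  - exact: measurable_set1_rV.
  - exact: measurable_xsection.
  - by move=> y ->; rewrite /xsection/= inE.
have mU : measurable (N `|` [set w | `|f w| >= 1%:E]) by exact: measurableU.
apply: le_trans (le_measure P _ _ sub) _; rewrite ?inE//.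
apply: le_trans (measureU2 _ mN mf1) _.
rewrite [X in X + _](_ : _ = 0) ?add0e//.
have := le_integral_abse P measurableT mf ltr01.
rewrite mul1e setTI => /le_trans; apply; rewrite /campbell le_eqVlt.
apply/orP; left; apply/eqP; apply: eq_integral => w _.
by rewrite gee0_abs ?measure_ge0.
Qed.

End campbell.

(** * The refined Campbell formula *)

Section palm.
Context {R : realType} {d : nat} {dO : measure_display}
  {Omega : measurableType dO} {P : probability Omega R}
  (Pi : {RV P >-> pmeasure R d}) {dO' : measure_display}
  {Omega' : measurableType dO'} {P' : probability Omega' R}
  (Pis : {RV P' >-> pmeasure R d}).

Definition recenter (u : Omega * 'rV[R]_d) : 'rV[R]_d * pmeasure R d :=
  (u.2, translate (- u.2)%R (Pi u.1)).

Lemma measurable_recenter : measurable_fun setT recenter.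
Proof.
apply: measurable_fun_pair => //.
have mp : measurable_fun setT
    (fun u : Omega * 'rV[R]_d => ((- u.2)%R, Pi u.1 : pmeasure R d)).
  apply: measurable_fun_pair.
    exact: measurableT_comp measurable_opprV measurable_snd.
  exact: measurableT_comp measurable_fst.
exact: measurableT_comp measurable_translate mp.
Qed.

(** The defining identity of the Palm version is the value of the Campbell
    measure, carried by (w, x) |-> (x, Pi w seen from x), on rectangles. *)
Lemma campbell_palm (S : set 'rV[R]_d) (B : set (pmeasure R d)) :
  is_palm_version P Pi P' Pis ->
  measurable S -> measurable B -> lebesgue_rV S < +oo ->
  campbell Pi (recenter @^-1` (S `*` B)) =
    intensity P Pi * lebesgue_rV S * P' (Pis @^-1` B).
Proof.
move=> palm mS mB Sfin; rewrite -palm//; apply: eq_integral => w _.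
rewrite pmeasure_counting -setIA; congr (counting (_ `&` _)).
apply/seteqP; split => x.
  by rewrite /xsection/= inE/= => -[Sx Bx]; split => //; exact/translate_image.
by move=> [Sx /translate_image Bx]; rewrite /xsection/= inE.
Qed.

(** Under the Campbell measure restricted to a ball, the location of a point
    and the configuration seen from it have as joint law a multiple of Lebesgue
    measure times the law of the Palm version. Countable additivity of
    intensity times lebesgue_rV is inherited from the Campbell measure, of
    which it is a marginal; the ball makes the total mass finite. *)
Lemma campbell_recenter_null {N : set ('rV[R]_d * pmeasure R d)} (r : R) :
  (0 < d)%N -> intensity P Pi < +oo -> is_palm_version P Pi P' Pis ->
  measurable N -> (forall x, P' (Pis @^-1` xsection N x) = 0) ->
  campbell Pi
    (recenter @^-1` (N `&` (ball (0 : 'rV[R]_d)%R r `*` setT))) = 0.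
Proof.
move=> d0 lambda_fin palm mN N0.
set K := ball (0 : 'rV[R]_d)%R r.
have mK : measurable K by exact: measurable_ball.
have mKT : measurable (recenter @^-1` (K `*` setT)).
  rewrite -[X in measurable X]setTI; apply: measurable_recenter => //.
  exact: measurableX.
pose C := mrestr (campbell Pi) mKT.
have [m mE] : exists m : {measure set ('rV[R]_d * pmeasure R d) -> \bar R},
    forall X, m X = C (recenter @^-1` X).
  by unshelve eexists (pushforward C recenter); [exact: measurable_recenter|].
have CE S B : measurable S -> measurable B -> m (S `*` B) =
    intensity P Pi * lebesgue_rV (S `&` K) * P' (Pis @^-1` B).
  move=> mS mB; rewrite mE /C /mrestr -preimage_setI -setXI setIT.
  apply: campbell_palm => //; first exact: measurableI.
  by apply: le_lt_trans (lebesgue_rV_ball_lty r d0); exact: le_lebesgue_rV.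
rewrite [LHS](_ : _ = m N); last by rewrite mE.
apply: (@product_null_sections _ _ _ _ _ m _ (distribution P' Pis)) => //.
- rewrite -setXTT CE// setTI preimage_setT probability_setT mule1.
  have lambda0 : 0 <= intensity P Pi.
    by apply: integral_ge0 => w _; exact: measure_ge0.
  by rewrite lte_mul_pinfty ?ge0_fin_numE//; exact: lebesgue_rV_ball_lty.
- by move=> S B mS mB; rewrite !CE// preimage_setT probability_setT mule1.
Qed.

End palm.

Theorem theorem5 (R : realType) (d : nat) (d_gt0 : (0 < d)%N)
  (dO : measure_display) (Omega : measurableType dO) (P : probability Omega R)
  (Pi : {RV P >-> pmeasure R d})
  (dO' : measure_display) (Omega' : measurableType dO')
  (P' : probability Omega' R) (Pis : {RV P' >-> pmeasure R d})
  (Pi_invariant : translation_invariant P Pi)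
  (intensity_gt0 : 0 < intensity P Pi) (intensity_lty : intensity P Pi < +oo)
  (Pis_palm : is_palm_version P Pi P' Pis)
  (Pis_prec : prec P' P (fun w => remove_point (Pis w) (0%R : 'rV[R]_d)) Pi) :
  deletion_tolerant P Pi.
Proof.
move=> Z Zpoint A mA PiA.
(* The pairs (x, nu), nu being the configuration seen from x, for which removing
   x from the configuration lands in A. *)
pose N := [set u : 'rV[R]_d * pmeasure R d |
  A (translate u.1 (remove_point u.2 0%R))].
have mN : measurable N.
  have mr : measurable_fun setT (fun u : 'rV[R]_d * pmeasure R d =>
      (u.1, remove_point u.2 0%R : pmeasure R d)).
    apply: measurable_fun_pair => //.
    exact: measurableT_comp measurable_remove_point0 measurable_snd.
  have mt := measurableT_comp measurable_translate mr.
  by rewrite -[X in measurable X]setTI; exact: mt.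
(* Its sections are null: A translated by -x is as null for Pi as A. *)
have N0 x : P' (Pis @^-1` xsection N x) = 0.
  have mAx : measurable (translate x @^-1` A : set (pmeasure R d)).
    have mp := measurableT_comp measurable_translate
      (measurable_pair1 x).
    by rewrite -[X in measurable X]setTI; exact: mp.
  rewrite (_ : _ @^-1` _ =
      (fun w => remove_point (Pis w) (0%R : 'rV[R]_d)) @^-1`
        (translate x @^-1` A)); last first.
    by apply/seteqP; split => w /=; rewrite /xsection/= inE.
  apply: Pis_prec => //.
  by rewrite -[X in P X]/((translate x \o Pi) @^-1` A) Pi_invariant.
pose Y n := recenter Pi @^-1`
  (N `&` (ball (0 : 'rV[R]_d)%R n%:R `*` setT)).
have mY n : measurable (Y n).
  rewrite -[X in measurable X]setTI; apply: measurable_recenter => //.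
  apply: measurableI => //; apply: measurableX => //; exact: measurable_ball.
have mYZ n : measurable [set w | Y n (w, Z w)].
  have mp : measurable_fun setT (fun w => (w, Z w)).
    exact: measurable_fun_pair.
  by rewrite -[X in measurable X]setTI; exact: mp.
have PY n : P [set w | Y n (w, Z w)] = 0.
  apply/eqP; rewrite -measure_le0.
  rewrite -(campbell_recenter_null Pi Pis n%:R
    d_gt0 intensity_lty Pis_palm mN N0).
  exact: point_le_campbell.
have -> : (fun w => remove_point (Pi w) (Z w)) @^-1` A =
    \bigcup_n [set w | Y n (w, Z w)].
  apply/seteqP; split => [w /= Aw|w [n _ [NwZ _]] /=].
    have [n _ Zn] : (\bigcup_n ball (0 : 'rV[R]_d)%R n%:R) (Z w).
      by rewrite bigcup_ball0.
    by exists n => //; split => //; rewrite /N/= -remove_point_translate.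
  by rewrite (remove_point_translate (Pi w)).
have mU : measurable (\bigcup_n [set w | Y n (w, Z w)]).
  exact: bigcupT_measurable.
apply/(negligibleP P mU); apply: negligible_bigcup => n.
exact/(negligibleP P (mYZ n))/PY.
Qed.
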